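(* Let $\mathcal A$ be a countable structure. The following are equivalent: (1) There is a continuous homomorphism from $\mathrm{Aut}(\mathcal A)$ onto $S_\infty$. (2) There are $n\in\omega$, an $\mathcal L_{\omega_1\omega}$-definable (without parameters) set $D\subseteq A^n$, and an $\mathcal L_{\omega_1\omega}$-definable equivalence relation $E\subseteq D^2$ with infinitely many equivalence classes such that the $E$-equivalence classes are absolutely indiscernible, i.e., every permutation of the set of $E$-equivalence classes extends to an automorphism of $\mathcal A$.
   Context: $S_\infty$ is the group of all permutations of $\omega$ with the topology of pointwise convergence; $\mathrm{Aut}(\mathcal A)$ carries the same topology as a subgroup of $S_\infty$ (the structure has domain $\omega$). An automorphism $g$ of $\mathcal A$ extends a permutation $h$ of the $E$-classes if $g$ (acting coordinatewise on $A^n$) maps each $E$-class $C$ onto $h(C)$. *)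

(* Defs.v *)
From HB Require Import structures.
From mathcomp Require Import all_boot monoid.
From mathcomp Require Import all_classical.
From mathcomp Require Import topology_structure initial_topology subtype_topology.
From mathcomp Require Import nat_topology function_spaces.

Set Implicit Arguments.
Unset Strict Implicit.
Unset Printing Implicit Defensive.

Local Open Scope classical_set_scope.

(** * The topological group of all permutations of the natural numbers *)

(* [nat] carries the discrete topology, [{ptws nat -> nat}] the topology of
   pointwise convergence and [set_type] the induced topology. *)
Definition Sinfty : Type := set_type [set f : {ptws nat -> nat} | bijective f].

HB.instance Definition _ := Topological.on Sinfty.
HB.instance Definition _ := SubChoice.on Sinfty.

Definition perm_fun (s : Sinfty) : nat -> nat := val s.
Coercion perm_fun : Sinfty >-> Funclass.

Lemma perm_bij (s : Sinfty) : bijective s.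
Proof. exact: set_valP s. Qed.

Lemma permP (s t : Sinfty) : s =1 t -> s = t.
Proof. by move=> st; apply/val_inj/funext. Qed.

Definition mk_perm (f : nat -> nat) (bf : bijective f) : Sinfty :=
  exist _ (f : {ptws nat -> nat}) (mem_set bf).

Lemma perm_inv_exists (s : Sinfty) :
  exists t : nat -> nat, cancel s t /\ cancel t s.
Proof. by case: (perm_bij s) => t st ts; exists t. Qed.

Definition perm_inv_fun (s : Sinfty) : nat -> nat :=
  projT1 (cid (perm_inv_exists s)).

Lemma perm_funK (s : Sinfty) : cancel s (perm_inv_fun s).
Proof. by rewrite /perm_inv_fun; case: cid => t []. Qed.

Lemma perm_inv_funK (s : Sinfty) : cancel (perm_inv_fun s) s.
Proof. by rewrite /perm_inv_fun; case: cid => t []. Qed.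

Definition perm_one : Sinfty :=
  mk_perm (Bijective (frefl id) (frefl id) : bijective (@id nat)).
Definition perm_mul (s t : Sinfty) : Sinfty :=
  mk_perm (bij_comp (perm_bij s) (perm_bij t)).
Definition perm_inv (s : Sinfty) : Sinfty :=
  mk_perm (Bijective (perm_inv_funK s) (perm_funK s)).

Lemma perm_mulA : associative perm_mul.
Proof. by move=> s t u; apply: permP. Qed.
Lemma perm_mul1 : left_id perm_one perm_mul.
Proof. by move=> s; apply: permP. Qed.
Lemma perm_mulr1 : right_id perm_one perm_mul.
Proof. by move=> s; apply: permP. Qed.
Lemma perm_mulV : left_inverse perm_one perm_inv perm_mul.
Proof. by move=> s; apply: permP => x; exact: perm_funK. Qed.
Lemma perm_mulrV : right_inverse perm_one perm_inv perm_mul.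
Proof. by move=> s; apply: permP => x; exact: perm_inv_funK. Qed.

HB.instance Definition _ :=
  isGroup.Build Sinfty perm_mulA perm_mul1 perm_mulr1 perm_mulV perm_mulrV.

(* The coordinatewise action on tuples. *)
Definition act n (s : Sinfty) (a : n.-tuple nat) : n.-tuple nat :=
  map_tuple s a.

Lemma act1 n (a : n.-tuple nat) : act 1%g a = a.
Proof. by apply/val_inj; rewrite /= map_id. Qed.

Lemma actM n (s t : Sinfty) (a : n.-tuple nat) :
  act (s * t)%g a = act s (act t a).
Proof. by apply/val_inj; rewrite /= -map_comp. Qed.

(** * Structures with domain the natural numbers *)

Record signature := Signature {
  rel_sym : Type;
  rel_arity : rel_sym -> nat;
  fun_sym : Type;
  fun_arity : fun_sym -> nat }.

Record structure (L : signature) := Structure {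
  rel_interp : forall R : rel_sym L, set ((rel_arity R).-tuple nat);
  fun_interp : forall F : fun_sym L, (fun_arity F).-tuple nat -> nat }.

Definition automorphism (L : signature) (A : structure L) : set Sinfty :=
  [set g | (forall (R : rel_sym L) (a : (rel_arity R).-tuple nat),
             rel_interp A (act g a) <-> rel_interp A a)
        /\ (forall (F : fun_sym L) (a : (fun_arity F).-tuple nat),
             fun_interp A (act g a) = g (fun_interp A a))].

Definition Aut (L : signature) (A : structure L) : Type :=
  set_type (automorphism A).

HB.instance Definition _ (L : signature) (A : structure L) :=
  Topological.on (Aut A).
HB.instance Definition _ (L : signature) (A : structure L) :=
  SubChoice.on (Aut A).

Lemma automorphism_group_closed (L : signature) (A : structure L) :
  group_closed (fun g => g \in automorphism A).
Proof.
suff cl : (automorphism A 1%g) /\ forall g h,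
    automorphism A g -> automorphism A h -> automorphism A (g / h)%g.
  split=> [|g h]; first exact/mem_set/(proj1 cl).
  by rewrite unfold_in => /set_mem Ag /set_mem Ah; apply/mem_set/(proj2 cl).
split=> [|g h [gR gF] [hR hF]]; first by split=> S a; rewrite act1.
split=> S a.
  by rewrite actM gR -hR -actM mulgV act1.
rewrite actM gF; congr (g _); apply: (bij_inj (perm_bij h)).
by rewrite -hF -actM mulgV act1; exact/esym/perm_inv_funK.
Qed.

HB.instance Definition _ (L : signature) (A : structure L) :=
  SubChoice_isSubGroup.Build Sinfty _ (Aut A) (automorphism_group_closed A).

(** * The infinitary logic with countable conjunctions and finite quantifiers *)

(* [term L n] and [formula L n] have their free variables among x_0, ...,
   x_(n-1). *)
Inductive term (L : signature) (n : nat) : Type :=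
| Var of 'I_n
| App (F : fun_sym L) of ('I_(fun_arity F) -> term L n).

(* Finite conjunctions and disjunctions are those of sequences with finite
   range. *)
Inductive formula (L : signature) : nat -> Type :=
| FEq n : term L n -> term L n -> formula L n
| FRel n (R : rel_sym L) : ('I_(rel_arity R) -> term L n) -> formula L n
| FNot n : formula L n -> formula L n
| FAnd n : (nat -> formula L n) -> formula L n
| FOr n : (nat -> formula L n) -> formula L n
| FForall n : formula L n.+1 -> formula L n
| FExists n : formula L n.+1 -> formula L n.

Fixpoint eval (L : signature) (A : structure L) n (a : n.-tuple nat)
    (t : term L n) : nat :=
  match t with
  | Var i => tnth a i
  | App F ts => fun_interp A [tuple eval A a (ts i) | i < fun_arity F]
  end.

(* A quantifier binds x_0 and shifts the other variables. *)
Fixpoint sat (L : signature) (A : structure L) n (phi : formula L n) :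
    n.-tuple nat -> Prop :=
  match phi in formula _ n return n.-tuple nat -> Prop with
  | FEq _ t u => fun a => eval A a t = eval A a u
  | FRel _ R ts => fun a =>
      rel_interp A [tuple eval A a (ts i) | i < rel_arity R]
  | FNot _ psi => fun a => ~ sat A psi a
  | FAnd _ psi => fun a => forall k, sat A (psi k) a
  | FOr _ psi => fun a => exists k, sat A (psi k) a
  | FForall _ psi => fun a => forall x, sat A psi (cons_tuple x a)
  | FExists _ psi => fun a => exists x, sat A psi (cons_tuple x a)
  end.

Definition definable (L : signature) (A : structure L) n
    (D : set (n.-tuple nat)) : Prop :=
  exists phi : formula L n, D = [set a | sat A phi a].

Definition definable2 (L : signature) (A : structure L) n
    (E : set (n.-tuple nat * n.-tuple nat)) : Prop :=
  definable A [set c : (n + n).-tuple nat |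
    exists a b, c = cat_tuple a b /\ E (a, b)].

(** * Equivalence relations and absolute indiscernibility *)

Definition equivalence_on (T : Type) (D : set T) (E : set (T * T)) : Prop :=
  [/\ E `<=` D `*` D,
      forall x, D x -> E (x, x),
      forall x y, E (x, y) -> E (y, x)
    & forall x y z, E (x, y) -> E (y, z) -> E (x, z)].

Definition eq_classes (T : Type) (D : set T) (E : set (T * T)) : set (set T) :=
  [set C | exists2 x, D x & C = [set y | E (x, y)]].

(* [h] is only relevant on the set of classes. *)
Definition extends_perm (L : signature) (A : structure L) n
    (D : set (n.-tuple nat)) (E : set (n.-tuple nat * n.-tuple nat))
    (h : set (n.-tuple nat) -> set (n.-tuple nat)) (g : Aut A) : Prop :=
  forall C, eq_classes D E C -> [set act (val g) a | a in C] = h C.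

Definition absolutely_indiscernible (L : signature) (A : structure L) n
    (D : set (n.-tuple nat)) (E : set (n.-tuple nat * n.-tuple nat)) : Prop :=
  forall h : set (n.-tuple nat) -> set (n.-tuple nat),
    set_bij (eq_classes D E) (eq_classes D E) h ->
    exists g : Aut A, extends_perm D E h g.

(* Main.v *)
(** From (2) to (1): an automorphism permutes the classes of a definable
    equivalence relation; enumerating them by the natural numbers gives the
    homomorphism, and absolute indiscernibility is its surjectivity.

    From (1) to (2): by continuity there is a finite tuple [a] whose pointwise
    stabilizer is mapped by [f] into the stabilizer of 0.  Take for [D] the orbit
    of [a] and identify [g a] with [h a] when [f g 0 = f h 0].  The classes
    correspond to the natural numbers, and [g] moves them as [f g] does.  Both
    sets are invariant under automorphisms, hence definable: as there are only
    countably many tuples, each type of the infinitary logic is isolated in [A]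
    by one formula, so that tuples of the same type are conjugate by a back and
    forth argument without ordinal ranks and over signatures of any cardinality. *)
From HB Require Import structures.
Require Import Defs.
From mathcomp Require Import all_boot monoid.
From mathcomp Require Import all_classical.
From mathcomp Require Import topology_structure initial_topology subtype_topology.
From mathcomp Require Import discrete_topology nat_topology function_spaces.

Set Implicit Arguments.
Unset Strict Implicit.
Unset Printing Implicit Defensive.

Local Open Scope classical_set_scope.

(** * Pointwise convergence of permutations and automorphisms *)

Lemma cvg_set_type (T : topologicalType) (S : set T) (F : set_system S) (x : S) :
  Filter F -> F --> x <-> val @ F --> val x.
Proof.
move=> FF; split=> [Fx|Fx U].
  by apply: cvg_trans (@initial_continuous _ T val x); exact: cvg_app.
case=> _ [[B oB <-]] Bx BU.
by apply: filterS BU _; apply: (Fx B); exact: open_nbhs_nbhs.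
Qed.

Lemma cvg_nat (F : set_system nat) (k : nat) : Filter F -> F --> k <-> F [set k].
Proof. by move=> FF; rewrite discrete_cvg. Qed.

Lemma cvg_Sinfty (F : set_system Sinfty) (s : Sinfty) :
  Filter F -> F --> s <-> forall k, \forall t \near F, perm_fun t k = s k.
Proof.
move=> FF.
have -> : F --> s <-> val @ F --> val s by exact: cvg_set_type.
have -> : val @ F --> val s <->
    forall k, (fun g : nat -> nat => g k) @ (val @ F) --> perm_fun s k.
  exact: pointwise_cvgP.
by split=> Fs k; [have /cvg_nat := Fs k | apply/cvg_nat; exact: Fs].
Qed.

Lemma val_AutM L (A : structure L) (g h : Aut A) :
  val (g * h)%g = (val g * val h)%g.
Proof. exact: valM. Qed.

Lemma cvg_Aut L (A : structure L) (F : set_system (Aut A)) (g : Aut A) :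
  Filter F ->
  F --> g <-> forall k, \forall h \near F, perm_fun (val h) k = perm_fun (val g) k.
Proof.
move=> FF.
have -> : F --> g <-> val @ F --> val g by exact: cvg_set_type.
exact: cvg_Sinfty.
Qed.

(** If no [n] worked, automorphisms outside [U] fixing longer and longer initial segments would form
    a sequence converging to the identity. *)
Lemma nbhs_pointwise_stabilizer L (A : structure L) (U : set (Aut A)) :
  nbhs (1%g : Aut A) U ->
  exists n, forall g : Aut A, (forall k, k < n -> perm_fun (val g) k = k) -> U g.
Proof.
move=> U1; apply: contrapT => /forallNP noN.
have /choice[u uP] : forall n, exists g : Aut A,
    (forall k, k < n -> perm_fun (val g) k = k) /\ ~ U g.
  move=> n; have /existsNP[g /not_implyP[gk nUg]] := noN n.
  by exists g.
have /(_ U U1)[n _ Un] : u @ \oo --> (1%g : Aut A).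
  apply/cvg_Aut => k; exists k.+1 => // n /= kn.
  by rewrite (proj1 (uP n)).
exact: (proj2 (uP n)) (Un n (leqnn n)).
Qed.

(** * Automorphisms preserve infinitary formulas *)

Section Scott.

Variables (L : signature) (A : structure L).

Lemma automorphismP (g : Aut A) : automorphism A (val g).
Proof. exact/set_mem/(valP g). Qed.

Lemma eval_act (g : Sinfty) n (a : n.-tuple nat) (t : term L n) :
  automorphism A g -> Defs.eval A (act g a) t = g (Defs.eval A a t).
Proof.
case=> _ gF; elim: t => [i|F ts IH] /=; first by rewrite tnth_map.
rewrite -gF; congr fun_interp; apply: eq_from_tnth => i.
by rewrite tnth_mktuple IH [RHS]tnth_map tnth_mktuple.
Qed.

(** Induction on the formula: equations use that [g] is injective, quantifiers that it is onto. *)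
Lemma sat_act (g : Sinfty) n (phi : formula L n) (a : n.-tuple nat) :
  automorphism A g -> sat A phi (act g a) <-> sat A phi a.
Proof.
move=> gA; have act_cons m (b : m.-tuple nat) x :
    cons_tuple (g x) (act g b) = act g (cons_tuple x b) by exact/val_inj.
elim: phi a => {n} [n t u|n R ts|n f IH|n f IH|n f IH|n f IH|n f IH] a /=.
- rewrite !eval_act //; split=> [|-> //].
  exact: (bij_inj (perm_bij g)).
- rewrite -[X in _ <-> X](proj1 gA); set b := (X in rel_interp A X <-> _).
  suff -> : b = act g [tuple Defs.eval A a (ts i) | i < rel_arity R] by [].
  by apply: eq_from_tnth => i; rewrite tnth_mktuple eval_act ?[RHS]tnth_map ?tnth_mktuple.
- by rewrite IH.
- by split=> H k; apply/IH.
- by split=> -[k H]; exists k; apply/IH.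
- split=> H x; first by rewrite -IH -act_cons.
  by rewrite -(perm_inv_funK g x) act_cons IH.
- split=> -[x H]; last by exists (g x); rewrite act_cons IH.
  exists (perm_inv_fun g x).
  by rewrite -IH -act_cons perm_inv_funK.
Qed.

(** * Infinitary types and their isolating formulas *)

Definition elem_equiv n (a b : n.-tuple nat) :=
  forall phi : formula L n, sat A phi a <-> sat A phi b.

Lemma elem_equiv_sym n (a b : n.-tuple nat) : elem_equiv a b -> elem_equiv b a.
Proof. by move=> ab phi; rewrite ab. Qed.

(** The quantifier supplies the variable, so this makes sense even for [n = 0]. *)
Definition FBot n : formula L n := FNot (FForall (FEq (Var L ord0) (Var L ord0))).

Lemma sat_FBot n (a : n.-tuple nat) : ~ sat A (FBot n) a.
Proof. by move=> /=; apply. Qed.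

(* There are only countably many tuples [b], and each one that is not equivalent
   to [a] is excluded by a single formula. *)
Lemma isolating_formula n (a : n.-tuple nat) :
  exists phi : formula L n, forall b, sat A phi b <-> elem_equiv a b.
Proof.
have /choice[psi psiP] : forall b : n.-tuple nat, exists phi : formula L n,
    sat A phi a /\ (sat A phi b -> elem_equiv a b).
  move=> b; have [ab|/existsNP[phi nab]] := EM (elem_equiv a b).
    by exists (FNot (FBot n)); split=> //; exact: sat_FBot.
  have [pa|npa] := EM (sat A phi a).
    by exists phi; split=> // pb; exfalso; apply: nab.
  by exists (FNot phi); split=> //= npb; exfalso; apply: nab.
(* A code [k] of no tuple falls back on [psi a], a conjunct that also holds at [a]. *)
exists (FAnd (fun k => psi (odflt a (unpickle k)))) => b; split=> /= [ab|ab k].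
  by apply: (proj2 (psiP b)); have := ab (pickle b); rewrite pickleK.
by rewrite -ab; exact: (proj1 (psiP _)).
Qed.

(** One formula isolates the type of [x] followed by [a]; that it is realized over [a] is again a
    formula, so it is realized over [b]. *)
Lemma elem_equiv_forth n (a b : n.-tuple nat) x :
  elem_equiv a b -> exists y, elem_equiv (cons_tuple x a) (cons_tuple y b).
Proof.
move=> ab; have [phi phiP] := isolating_formula (cons_tuple x a).
have /ab[y /phiP ?] : sat A (FExists phi) a by exists x; exact/phiP.
by exists y.
Qed.

(** Lengths computed from lists of pairs agree only propositionally, so tuples are compared as
    sequences. *)
Lemma elem_equiv_cast n m (a b : n.-tuple nat) (a' b' : m.-tuple nat) :
  val a = val a' -> val b = val b' -> elem_equiv a b -> elem_equiv a' b'.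
Proof.
move=> aa' bb'; have nm : n = m by rewrite -(size_tuple a) -(size_tuple a') aa'.
by case: m / nm a' b' aa' bb' => a' b' /val_inj<- /val_inj<-.
Qed.

(** * Finite partial elementary maps and the back and forth *)

Definition partial_elem (p : seq (nat * nat)) :=
  elem_equiv (map_tuple fst (in_tuple p)) (map_tuple snd (in_tuple p)).

Lemma partial_elem_extend p k : partial_elem p ->
  exists x y, partial_elem [:: (x, k), (k, y) & p].
Proof.
move=> /(elem_equiv_forth k)[y ky].
have /elem_equiv_sym/(elem_equiv_forth k)[x xk] : partial_elem ((k, y) :: p).
  by apply: elem_equiv_cast ky.
by exists x, y; apply: elem_equiv_cast (elem_equiv_sym xk).
Qed.

(** The positions [v i] serve as variables: they turn an atomic statement about [c] into a formula
    evaluated at both sides of [p]. *)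
Lemma partial_elem_index p (f : nat -> nat) m (c : m.-tuple nat) :
  (forall i, (tnth c i, f (tnth c i)) \in p) ->
  exists v : 'I_m -> 'I_(size p), forall i,
    tnth (map_tuple fst (in_tuple p)) (v i) = tnth c i /\
    tnth (map_tuple snd (in_tuple p)) (v i) = f (tnth c i).
Proof.
move=> cp; suff /choice[v vP] : forall i, exists j : 'I_(size p),
    tnth (in_tuple p) j = (tnth c i, f (tnth c i)).
  by exists v => i; rewrite !tnth_map vP.
move=> i; have /(tnthP (in_tuple p))[j ij] : (tnth c i, f (tnth c i)) \in in_tuple p.
  exact: cp.
by exists j.
Qed.

(** The equation between two variables is preserved both ways, so the graph [p] is single-valued and
    injective. *)
Lemma partial_elem_eq p x y x' y' : partial_elem p ->
  (x, y) \in p -> (x', y') \in p -> x = x' <-> y = y'.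
Proof.
move=> pp /(tnthP (in_tuple p))[i iE] /(tnthP (in_tuple p))[j jE].
have := pp (FEq (Var L i) (Var L j)).
by rewrite /= !tnth_map -iE -jE.
Qed.

Lemma partial_elem_rel p (f : nat -> nat) R (a : (rel_arity R).-tuple nat) :
  partial_elem p -> (forall i, (tnth a i, f (tnth a i)) \in p) ->
  rel_interp A (map_tuple f a) <-> rel_interp A a.
Proof.
move=> pp /partial_elem_index[v vP].
have := pp (FRel (fun i => Var L (v i))) => /= H.
have [<- <-] : [tuple tnth (map_tuple fst (in_tuple p)) (v i) | i < rel_arity R] = a
    /\ [tuple tnth (map_tuple snd (in_tuple p)) (v i) | i < rel_arity R]
       = map_tuple f a.
  by split; apply: eq_from_tnth => i; rewrite tnth_mktuple ?[RHS]tnth_map; case: (vP i).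
by rewrite H.
Qed.

Lemma partial_elem_fun p (f : nat -> nat) F (a : (fun_arity F).-tuple nat) :
  partial_elem p -> (forall i, (tnth a i, f (tnth a i)) \in p) ->
  (fun_interp A a, f (fun_interp A a)) \in p ->
  fun_interp A (map_tuple f a) = f (fun_interp A a).
Proof.
move=> pp /partial_elem_index[v vP] /(tnthP (in_tuple p))[w wE].
have := pp (FEq (App (fun i => Var L (v i))) (Var L w)) => /=.
have [-> ->] : [tuple tnth (map_tuple fst (in_tuple p)) (v i) | i < fun_arity F] = a
    /\ [tuple tnth (map_tuple snd (in_tuple p)) (v i) | i < fun_arity F]
       = map_tuple f a.
  by split; apply: eq_from_tnth => i; rewrite tnth_mktuple ?[RHS]tnth_map; case: (vP i).
by rewrite !tnth_map -wE /=; case=> + _; exact.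
Qed.

(* The partial elementary map grows by [(x, k)] and [(k, y)] at stage [k], so the
   union of the chain is total and onto. *)
Lemma elem_equiv_automorphism n (a b : n.-tuple nat) :
  elem_equiv a b -> exists g : Aut A, act (val g) a = b.
Proof.
move=> ab.
have /choice[ext extP] : forall pk : seq (nat * nat) * nat, exists q,
    partial_elem pk.1 -> partial_elem q /\
      exists x y, q = [:: (x, pk.2), (pk.2, y) & pk.1].
  move=> [p k] /=; have [/partial_elem_extend|npp] := EM (partial_elem p).
    move=> /(_ k)[x [y pxy]]; exists [:: (x, k), (k, y) & p] => _.
    by split=> //; exists x, y.
  by exists p.
pose p0 := zip a b.
have sab : size a = size b by rewrite !size_tuple.
pose chain k := iteri k (fun k p => ext (p, k)) p0.
have chain_elem k : partial_elem (chain k).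
  elim: k => [|k /(extP (_, k))[]//].
  apply: elem_equiv_cast ab; first exact/esym/unzip1_zip/eq_leq.
  exact/esym/unzip2_zip/eq_leq.
have chainS k : exists x y, chain k.+1 = [:: (x, k), (k, y) & chain k].
  by have /(extP (_, k))[_] := chain_elem k.
have chain_sub i j : i <= j -> {subset chain i <= chain j}.
  move=> /subnK<-; elim: (j - i) => // {}j IH z /IH zj.
  rewrite addSn; have [x [y ->]] := chainS (j + i).
  by rewrite !inE zj !orbT.
have /choice[f fP] : forall x, exists y, (x, y) \in chain x.+1.
  by move=> x; have [z [y ->]] := chainS x; exists y; rewrite !inE eqxx orbT.
have /choice[f' f'P] : forall y, exists x, (x, y) \in chain y.+1.
  by move=> y; have [x [z ->]] := chainS y; exists x; rewrite !inE eqxx.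
(* Two pairs from any stages lie in a common stage, so the union is the graph of an injective
   function. *)
have chain_eq i j x y x' y' : (x, y) \in chain i -> (x', y') \in chain j ->
    x = x' <-> y = y'.
  move=> xyi xyj; apply: (@partial_elem_eq (chain (maxn i j))) => //.
    by apply: chain_sub xyi; exact: leq_maxl.
  by apply: chain_sub xyj; exact: leq_maxr.
have fK : cancel f f' by move=> x; apply/(chain_eq _ _ _ _ _ _ (f'P _) (fP x)).
have f'K : cancel f' f by move=> y; apply/(chain_eq _ _ _ _ _ _ (fP _) (f'P y)).
pose g := mk_perm (Bijective fK f'K).
have chain_max m (c : m.-tuple nat) :
    exists k, forall j, k <= j -> forall i, (tnth c i, f (tnth c i)) \in chain j.
  (* The pair of [x] is present from stage [x.+1] on, so the largest entry of [c] decides. *)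
  exists (\max_(x <- c) x).+1 => j cj i; apply: chain_sub (fP _).
  by apply: leq_trans cj; rewrite ltnS; apply: leq_bigmax_seq => //; exact: mem_tnth.
have gA : automorphism A g.
  split=> [R|F] c; have [k kP] := chain_max _ c.
    by apply: (partial_elem_rel (chain_elem k)); exact: kP.
  (* The stage must contain the pair of the function value too. *)
  pose j := maxn k (fun_interp A c).+1.
  apply: (partial_elem_fun (chain_elem j)); first by apply: kP; exact: leq_maxl.
  by apply: chain_sub (fP _); exact: leq_maxr.
exists (exist _ g (mem_set gA)); apply: eq_from_tnth => i; rewrite tnth_map.
have abi : (tnth a i, tnth b i) \in chain 0.
  rewrite !(tnth_nth 0) -nth_zip //; apply: mem_nth.
  by rewrite size_zip sab minnn size_tuple.
exact/(chain_eq _ _ _ _ _ _ (fP _) abi).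
Qed.

(** * Definable sets are the invariant sets *)

Lemma definable_act n (D : set (n.-tuple nat)) : definable A D ->
  forall (g : Aut A) a, D (act (val g) a) <-> D a.
Proof. by case=> phi -> g a; apply: sat_act; exact: automorphismP. Qed.

(** An invariant set is a union of orbits; each orbit is defined by an isolating formula, and
    countably many of them form a disjunction. *)
Lemma definable_invariant n (D : set (n.-tuple nat)) :
  (forall (g : Aut A) a, D a -> D (act (val g) a)) -> definable A D.
Proof.
move=> Dinv; have /choice[phi phiP] := @isolating_formula n.
exists (FOr (fun k => if unpickle k is Some a then
                   if `[< D a >] then phi a else FBot n else FBot n)).
apply/seteqP; split=> [a Da|b [k]] /=.
  exists (pickle a); rewrite pickleK.
  by case: asboolP => // _; exact/phiP.
case: unpickle => [a|] /=; last by move/sat_FBot.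
case: asboolP => [Da|_ /sat_FBot//] /phiP/elem_equiv_automorphism[g <-].
exact: Dinv.
Qed.

Lemma act_cat n m (g : Sinfty) (a : n.-tuple nat) (b : m.-tuple nat) :
  act g (cat_tuple a b) = cat_tuple (act g a) (act g b).
Proof. by apply: val_inj; rewrite /= map_cat. Qed.

Lemma cat_tuple_inj n m (a a' : n.-tuple nat) (b b' : m.-tuple nat) :
  cat_tuple a b = cat_tuple a' b' -> a = a' /\ b = b'.
Proof.
move=> /(congr1 val)/eqP; rewrite /= eqseq_cat ?size_tuple //.
by move=> /andP[/eqP/val_inj-> /eqP/val_inj->].
Qed.

Lemma definable2_act n (E : set (n.-tuple nat * n.-tuple nat)) :
  definable2 A E ->
  forall (g : Aut A) a b, E (act (val g) a, act (val g) b) <-> E (a, b).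
Proof.
move=> dE g a b; have := definable_act dE g (cat_tuple a b); rewrite act_cat.
have catE c d : (exists a b, cat_tuple c d = cat_tuple a b /\ E (a, b)) <-> E (c, d).
  by split=> [[c' [d' [/cat_tuple_inj[-> ->]]]]//|Ecd]; exists c, d.
by rewrite /= !catE.
Qed.

Lemma definable2_invariant n (E : set (n.-tuple nat * n.-tuple nat)) :
  (forall (g : Aut A) a b, E (a, b) -> E (act (val g) a, act (val g) b)) ->
  definable2 A E.
Proof.
move=> Einv; apply: definable_invariant => g _ [a [b [-> Eab]]].
by exists (act (val g) a), (act (val g) b); rewrite act_cat; split=> //; exact: Einv.
Qed.

End Scott.

(** * The homomorphism given by indiscernible classes *)

Lemma eq_classes_disjoint (T : Type) (D : set T) (E : set (T * T)) (B C : set T) x :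
  equivalence_on D E -> eq_classes D E B -> eq_classes D E C ->
  B x -> C x -> B = C.
Proof.
case=> _ _ Esym Etrans [b _ ->] [c _ ->] /= bx cx; apply/seteqP.
have bc := Etrans _ _ _ bx (Esym _ _ cx).
by split=> y /=; [apply: (Etrans _ _ _ (Esym _ _ bc)) | apply: (Etrans _ _ _ bc)].
Qed.

Lemma eq_classes_act L (A : structure L) n (D : set (n.-tuple nat))
    (E : set (n.-tuple nat * n.-tuple nat)) (g : Aut A) (C : set (n.-tuple nat)) :
  definable A D -> definable2 A E -> eq_classes D E C ->
  eq_classes D E [set act (val g) a | a in C].
Proof.
move=> Ddef Edef [x Dx ->]; exists (act (val g) x); first exact/definable_act.
apply/seteqP; split=> [_ [y /= Exy <-]|y /= Egxy] /=.
  exact/(definable2_act Edef).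
have gK z : act (val g) (act (val g)^-1%g z) = z by rewrite -actM mulgV act1.
exists (act (val g)^-1%g y); last exact: gK.
by apply/(definable2_act Edef g); rewrite gK.
Qed.

Lemma enum_eq_classes (T : countType) (D : set T) (E : set (T * T)) :
  infinite_set (eq_classes D E) ->
  exists2 e : nat -> set T, injective e & eq_classes D E = range e.
Proof.
move=> inf; have classesE : eq_classes D E = [set [set y | E (x, y)] | x in D].
  by apply/seteqP; split=> C [x Dx]; exists x.
have cnt : countable (eq_classes D E).
  by rewrite classesE; apply: sub_countable (card_image_le _ _) _; exact: countableP.
have /card_esym/card_set_bijP[e [efun einj esurj]] := eq_card_nat cnt inf.
exists e; first by move=> k l; apply: einj; exact: in_setT.
by apply/seteqP; split=> [C /esurj//|_ [k _ <-]]; exact: efun.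
Qed.

Lemma near_act L (A : structure L) n (g : Aut A) (a : n.-tuple nat) :
  \forall h \near g, act (val h) a = act (val g) a.
Proof.
have ptw k : \forall h \near g, perm_fun (val h) k = perm_fun (val g) k.
  exact: (proj1 (cvg_Aut g (nbhs_filter g)) cvg_id).
have := filter_forall (nbhs_filter g) (fun i => ptw (tnth a i)).
by apply: filterS => h hg; apply: eq_from_tnth => i; rewrite !tnth_map hg.
Qed.

Lemma hom_of_indiscernibles L (A : structure L) n (D : set (n.-tuple nat))
    (E : set (n.-tuple nat * n.-tuple nat)) :
  definable A D -> definable2 A E -> equivalence_on D E ->
  infinite_set (eq_classes D E) -> absolutely_indiscernible A D E ->
  exists f : {multiplicative Aut A -> Sinfty},
    continuous f /\ range f = [set: Sinfty].
Proof.
move=> Ddef Edef Eeq /enum_eq_classes[e einj classesE] indisc.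
have class_e k : eq_classes D E (e k) by rewrite classesE.
have /choice[F FP] : forall g : Aut A, exists s : nat -> nat,
    forall k, [set act (val g) a | a in e k] = e (s k).
  move=> g; suff /choice[s sP] : forall k, exists l,
    [set act (val g) a | a in e k] = e l by exists s.
  move=> k; have := eq_classes_act g Ddef Edef (class_e k).
  by rewrite classesE => -[l _ <-]; exists l.
have Funiq g k l : [set act (val g) a | a in e k] = e l -> F g k = l.
  by rewrite FP => /einj.
have F1 : F 1%g =1 id.
  move=> k; apply: Funiq; apply/seteqP; split=> [_ [a ea <-]|a ea].
    by rewrite act1.
  by exists a; rewrite ?act1.
have FM g h : F (g * h)%g =1 F g \o F h.
  move=> k; apply: Funiq; rewrite -[(F g \o F h) k]/(F g (F h k)) -!FP; apply/seteqP.
  split=> [_ [a ea <-]|_ [_ [a ea <-] <-]].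
    by rewrite val_AutM actM; exists (act (val h) a) => //; exists a.
  by exists a; rewrite ?val_AutM ?actM.
have FK g : cancel (F g) (F g^-1%g).
  by move=> k; rewrite -[LHS]FM mulVg F1.
have FVK g : cancel (F g^-1%g) (F g).
  by move=> k; rewrite -[LHS]FM mulgV F1.
pose f g := mk_perm (Bijective (FK g) (FVK g)).
have fM : {morph f : g h / (g * h)%g} by move=> g h; apply: Defs.permP; exact: FM.
pose hom : {multiplicative Aut A -> Sinfty} :=
  HB.pack f (isMultiplicative.Build _ _ f fM).
exists hom; split=> /=.
  move=> g; apply/(cvg_Sinfty _ (fmap_filter f (nbhs_filter g))) => k.
  (* Classes are disjoint, so the image of one representative [a] determines [F g k], and that image
     is locally constant in [g]. *)
  have [a ea] : e k !=set0.
    by have [x Dx ->] := class_e k; exists x; case: Eeq => _ + _ _; apply.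
  have := near_act g a; apply: filterS => h hg.
  apply: einj; apply: (@eq_classes_disjoint _ _ _ _ _ (act (val g) a) Eeq) => //.
    by rewrite -FP -hg; exists a.
  by rewrite -FP; exists a.
apply/seteqP; split=> // s _.
(* [h] moves the classes as [s] moves their indices; off the classes its value [set0] is
   arbitrary. *)
have /choice[h hP] : forall C, exists C', forall k, C = e k -> C' = e (s k).
  move=> C; have [[k ->]|nC] := EM (exists k, C = e k).
    by exists (e (s k)) => l /einj->.
  by exists set0 => k Ck; case: nC; exists k.
have he k : h (e k) = e (s k) by exact: hP.
have [|g gP] := indisc h.
  rewrite classesE; split=> [_ [k _ <-]|C C'|_ [k _ <-]].
  - by rewrite he; exists (s k).
  - move=> /set_mem[k _ <-] /set_mem[l _ <-].
    by rewrite !he => /einj/(bij_inj (perm_bij s))->.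
  - exists (e (perm_inv_fun s k)); first by exists (perm_inv_fun s k).
    by rewrite he perm_inv_funK.
exists g => //; apply: Defs.permP => k; apply: Funiq.
by rewrite gP // he.
Qed.

(** * The indiscernible classes given by a homomorphism *)

Lemma indiscernibles_of_hom L (A : structure L)
    (f : {multiplicative Aut A -> Sinfty}) :
  continuous f -> range f = [set: Sinfty] ->
  exists (n : nat) (D : set (n.-tuple nat))
         (E : set (n.-tuple nat * n.-tuple nat)),
    [/\ definable A D,
        definable2 A E,
        equivalence_on D E,
        infinite_set (eq_classes D E)
      & absolutely_indiscernible A D E].
Proof.
move=> fcont fsurj.
have f1 : f 1%g = 1%g.
  by apply: (@mulgI _ (f 1%g)); rewrite -gmulfM !mulg1.
have /nbhs_pointwise_stabilizer[n stab] :
    \forall g \near (1%g : Aut A), perm_fun (f g) 0 = 0.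
  have := proj1 (cvg_Sinfty _ (fmap_filter f (nbhs_filter (1%g : Aut A)))) (fcont 1%g) 0.
  by rewrite f1.
pose a : n.-tuple nat := [tuple val i | i < n].
(* If [g] and [h] agree on [a], then [h^-1 * g] fixes every [k < n], so its image under [f] fixes
   0. *)
have fa (g h : Aut A) : act (val g) a = act (val h) a ->
    perm_fun (f g) 0 = perm_fun (f h) 0.
  move=> gha; rewrite -[g](mulVKg h) gmulfM /=.
  suff hg0 : perm_fun (f (h^-1 * g)%g) 0 = 0 by rewrite -[in RHS]hg0.
  apply: stab => k kn.
  have ghk : perm_fun (val g) k = perm_fun (val h) k.
    have := congr1 (fun t => tnth t (Ordinal kn)) gha.
    by rewrite !tnth_map tnth_ord_tuple.
  have -> : perm_fun (val (h^-1 * g)%g) k =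
            perm_fun (val h^-1%g) (perm_fun (val g) k) by rewrite val_AutM.
  have -> : perm_fun (val h^-1%g) (perm_fun (val g) k) =
            perm_fun (val (h^-1 * h)%g) k by rewrite val_AutM ghk.
  by rewrite mulVg val1.
have f_onto (s : Sinfty) : exists g, f g = s.
  have : [set: Sinfty] s by [].
  by rewrite -fsurj => -[g _ <-]; exists g.
(* [C k] is the [k]-th class: since [fa] holds, the value [f g 0] depends only on
   the tuple [act g a]. *)
pose C k := [set act (val g) a | g in [set g : Aut A | perm_fun (f g) 0 = k]].
have Cuniq k l b : C k b -> C l b -> k = l.
  by move=> [g <- <-] [h <- /fa ->].
have C0 k : C k !=set0.
  (* A preimage under [f] of the transposition of 0 and [k] witnesses that [C k] is inhabited. *)
  have tbij : bijective (fun x => if x == 0 then k else if x == k then 0 else x).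
    apply: inv_bij => x; have [->|x0] := eqVneq x 0.
      by case: eqVneq => // _; rewrite eqxx.
    by have [->//|xk] := eqVneq x k; rewrite (negbTE x0) (negbTE xk).
  have [g gE] := f_onto (mk_perm tbij).
  by exists (act (val g) a), g => //=; rewrite gE.
have Cinj : injective C.
  by move=> k l kl; have [b Cb] := C0 k; apply: (Cuniq _ _ b); rewrite -?kl.
have Cact (g : Aut A) k b : C k b -> C (perm_fun (f g) k) (act (val g) b).
  by move=> [h <- <-]; exists (g * h)%g; [rewrite /= gmulfM|rewrite val_AutM actM].
pose D := \bigcup_k C k.
pose E := [set bc | exists2 k, C k bc.1 & C k bc.2].
have classesE : eq_classes D E = range C.
  have classE k b : C k b -> [set c | E (b, c)] = C k.
    move=> Ckb; apply/seteqP; split=> [c [l /= Clb]|c Ckc]; last by exists k.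
    by rewrite (Cuniq _ _ _ Ckb Clb).
  apply/seteqP; split=> [_ [b [k _ Ckb] ->]|_ [k _ <-]].
    by exists k => //; rewrite (classE k).
  by have [b Ckb] := C0 k; exists b; [exists k | rewrite (classE k)].
exists n, D, E; split.
- by apply: definable_invariant => g b [k _ /Cact Cb]; exists (perm_fun (f g) k).
- apply: definable2_invariant => g b c [k /= /Cact Cb /Cact Cc].
  by exists (perm_fun (f g) k).
- split=> [[b c] [k Cb Cc]|b [k _ Cb]|b c [k Cb Cc]|b c d [k Cb Cc] [l /= Cc' Cd]].
  + by split; exists k.
  + by exists k.
  + by exists k.
  + by exists k => //=; rewrite (Cuniq _ _ _ Cc Cc').
- rewrite classesE; apply/infiniteP.
  have /card_eqPle[] // : (range C #= [set: nat])%card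
    by apply: inj_card_eq => k l _ _ /Cinj.
- move=> h; rewrite classesE => -[hfun hinj hsurj].
  (* [h] induces a permutation [s] of the indices; any [g] with [f g = s] extends [h], by [Cact]. *)
  have /choice[s sP] : forall k, exists l, h (C k) = C l.
    by move=> k; have [|l _ <-] := hfun (C k); [exists k | exists l].
  have sinj : injective s.
    move=> k l skl; apply/Cinj/hinj; rewrite ?inE; [by exists k|by exists l|].
    by rewrite !sP skl.
  have /choice[t tP] : forall l, exists k, s k = l.
    move=> l; have [|_ [k _ <-]] := hsurj (C l); first by exists l.
    by rewrite sP => /Cinj; exists k.
  have tsK : cancel s t by move=> k; exact/sinj/tP.
  have [g gE] := f_onto (mk_perm (Bijective tsK tP)).
  have fg k : perm_fun (f g) k = s k by rewrite gE.
  exists g => B; rewrite classesE => -[k _ <-]; rewrite sP -fg.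
  apply/seteqP; split=> [_ [b Cb <-]|b Cb]; first exact: Cact.
  (* [Cact] for the inverse of [g] brings [b] back into [C k]. *)
  exists (act (val g^-1%g) b).
    have := Cact g^-1%g _ _ Cb.
    by rewrite -[perm_fun (f g^-1%g) _]/(perm_fun (f g^-1 * f g)%g k) -gmulfM mulVg f1.
  by rewrite -actM -val_AutM mulgV val1 act1.
Qed.

Theorem theorem1p4 (L : signature) (A : structure L) :
  (exists f : {multiplicative Aut A -> Sinfty},
     continuous f /\ range f = [set: Sinfty])
  <->
  (exists (n : nat) (D : set (n.-tuple nat))
          (E : set (n.-tuple nat * n.-tuple nat)),
     [/\ definable A D,
         definable2 A E,
         equivalence_on D E,
         infinite_set (eq_classes D E)
       & absolutely_indiscernible A D E]).
Proof.
split=> [[f [fcont fsurj]]|[n [D [E [Ddef Edef Eeq Einf Eind]]]]].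
  exact: indiscernibles_of_hom fcont fsurj.
exact: hom_of_indiscernibles Ddef Edef Eeq Einf Eind.
Qed.
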